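(* Let $\Omega\subset\mathbb{R}^n$ be a bounded open set. Any viscosity solution $u$ of $\Delta_\infty u-|Du|^2=0$ in $\Omega$ is a viscosity supersolution of $\frac{\Delta_\infty u}{|Du|^2}=1$ in $\Omega$.
   Context: $\Delta_\infty u=\sum_{i,j=1}^n u_{x_i}u_{x_j}u_{x_ix_j}$. Viscosity solution of $\Delta_\infty u-|Du|^2=0$: $u$ continuous, and whenever $\phi\in C^2$ and $u-\phi$ has a local maximum (resp. minimum) at $x$, $\Delta_\infty\phi(x)-|D\phi(x)|^2\ge0$ (resp. $\le0$). Viscosity supersolution of $\frac{\Delta_\infty u}{|Du|^2}=1$: whenever $\phi\in C^2(\Omega)$ and $u-\phi$ has a local minimum at $x\in\Omega$, then $\frac{\Delta_\infty\phi(x)}{|D\phi(x)|^2}\le1$ if $D\phi(x)\ne0$, and $\min_{|p|=1}p\cdot D^2\phi(x)\,p\le1$ if $D\phi(x)=0$. *)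

(* Defs.v *)
From HB Require Import structures.
From mathcomp Require Import all_boot all_order all_algebra.
From mathcomp Require Import all_classical all_reals all_analysis.
Set Implicit Arguments. Unset Strict Implicit. Unset Printing Implicit Defensive.
Import Order.TTheory GRing.Theory Num.Theory.
Import numFieldNormedType.Exports.
Local Open Scope classical_set_scope.
Local Open Scope ring_scope.

Section InftyLap.
Variables (R : realType) (n : nat).

Definition evec (i : 'I_n) : 'rV[R]_n := delta_mx 0 i.

Definition partial (f : 'rV[R]_n -> R) (i : 'I_n) (x : 'rV[R]_n) : R :=
  derive f x (evec i).

Definition grad (f : 'rV[R]_n -> R) (x : 'rV[R]_n) : 'rV[R]_n :=
  \row_i partial f i x.
Definition hess (f : 'rV[R]_n -> R) (x : 'rV[R]_n) : 'M[R]_n :=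
  \matrix_(i, j) partial (partial f j) i x.

Definition C2_on (O : set 'rV[R]_n) (f : 'rV[R]_n -> R) : Prop :=
  {within O, continuous f} /\
  (forall i : 'I_n, {within O, continuous (partial f i)}) /\
  (forall i j : 'I_n, {within O, continuous (partial (partial f i) j)}) /\
  (forall x, O x -> forall i : 'I_n,
      derivable f x (evec i) /\
      forall j : 'I_n, derivable (partial f i) x (evec j)).

Definition grad_norm2 (f : 'rV[R]_n -> R) (x : 'rV[R]_n) : R :=
  \sum_(i < n) (grad f x 0 i) ^+ 2.

Definition inf_lap (f : 'rV[R]_n -> R) (x : 'rV[R]_n) : R :=
  \sum_(i < n) \sum_(j < n) grad f x 0 i * grad f x 0 j * hess f x i j.

Definition min_quad (A : 'M[R]_n) : R :=
  inf [set (\sum_(i < n) \sum_(j < n) p 0 i * A i j * p 0 j) |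
        p in [set p : 'rV[R]_n | \sum_(i < n) p 0 i ^+ 2 = 1]].

Definition loc_max (g : 'rV[R]_n -> R) (x : 'rV[R]_n) : Prop :=
  \forall y \near x, g y <= g x.
Definition loc_min (g : 'rV[R]_n -> R) (x : 'rV[R]_n) : Prop :=
  \forall y \near x, g x <= g y.

Definition visc_sol_inflap_grad (O : set 'rV[R]_n) (u : 'rV[R]_n -> R) : Prop :=
  {within O, continuous u} /\
  forall (phi : 'rV[R]_n -> R) (x : 'rV[R]_n), C2_on O phi -> O x ->
    (loc_max (fun y => u y - phi y) x -> inf_lap phi x - grad_norm2 phi x >= 0) /\
    (loc_min (fun y => u y - phi y) x -> inf_lap phi x - grad_norm2 phi x <= 0).

Definition visc_supersol_normalized (O : set 'rV[R]_n) (u : 'rV[R]_n -> R) : Prop :=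
  forall (phi : 'rV[R]_n -> R) (x : 'rV[R]_n), C2_on O phi -> O x ->
    loc_min (fun y => u y - phi y) x ->
    (grad phi x != 0 -> inf_lap phi x / grad_norm2 phi x <= 1) /\
    (grad phi x = 0 -> min_quad (hess phi x) <= 1).

End InftyLap.

(* Main.v *)
Require Import Defs.
From HB Require Import structures.
From mathcomp Require Import all_boot all_order all_algebra.
From mathcomp Require Import all_classical all_reals all_analysis.
From mathcomp Require Import ring lra.
Set Implicit Arguments. Unset Strict Implicit. Unset Printing Implicit Defensive.
Import Order.TTheory GRing.Theory Num.Theory.
Import numFieldNormedType.Exports.
Local Open Scope classical_set_scope.
Local Open Scope ring_scope.

(** Only a zero gradient needs an argument. If [D phi x = 0] and
    [D^2 phi x > 1] as a quadratic form, then near [x] the function [u] lies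
    above [u x + m/2 |y - x|^2] for some [m > 1]. Fix [1 < c < m] and a point
    [z <> x] close to [x]. The minimum of [u - c/2 |. - z|^2] over a small
    closed ball about [x] is interior because [c < m], so the paraboloid is a
    test function there; since [c > 1] it satisfies the supersolution inequality
    only at its centre, so the minimum is at [z]. Comparing with the value at
    [x] gives [u x > u z], against the growth of [u] away from [x]. *)

(** * Directional derivatives from continuous partial derivatives *)

Lemma is_derive_line (R : realType) (V : normedModType R) (f : V -> R)
    (x v : V) (t d : R) :
  is_derive (t *: v + x) v f d ->
  is_derive t 1 (fun s : R => f (s *: v + x)) d.
Proof.
have E : (fun h : R => h^-1 *: (((fun s : R => f (s *: v + x)) \o shift t)
      (h *: 1) - f (t *: v + x))) =
    (fun h : R => h^-1 *: ((f \o shift (t *: v + x)) (h *: v)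
      - f (t *: v + x))).
  by apply/funext => h /=; rewrite [h *: 1]mulr1 scalerDl addrA.
by move=> [df Df]; split; rewrite /derivable /derive E.
Qed.

(** The increment [l] may have either sign, because below it is [h * a] with [h] tending to 0 from
    both sides; hence the symmetric range for [s]. *)
Lemma MVT_line (R : realType) (V : normedModType R) (f : V -> R)
    (x v : V) (l : R) :
  (forall s : R, `|s| <= `|l| -> derivable f (s *: v + x) v) ->
  exists2 s : R, `|s| <= `|l| &
    f (l *: v + x) - f x = l * 'D_v f (s *: v + x).
Proof.
move=> df.
pose g (s : R) := f (s *: v + x).
have g0 : g 0 = f x by rewrite /g scale0r add0r.
have dg (s : R) : `|s| <= `|l| -> is_derive s 1 g ('D_v f (s *: v + x)).
  by move=> sl; apply: is_derive_line; apply: derivableP; exact: df.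
have [l0|l0] := leP 0 l.
- have itv s : s \in `[0, l] -> `|s| <= `|l|.
    by rewrite in_itv /= => /andP[s0 sl]; rewrite !ger0_norm.
  have [||s sl E] := @MVT_segment R g (fun s => 'D_v f (s *: v + x)) _ _ l0.
  + by move=> s sl; apply/dg/itv/subset_itv_oo_cc.
  + by apply: derivable_within_continuous => s /itv/dg[].
  by exists s; [exact: itv|rewrite -g0 -/(g l) E subr0 mulrC].
- have itv s : s \in `[l, 0] -> `|s| <= `|l|.
    rewrite in_itv /= => /andP[sl s0].
    by rewrite !ler0_norm ?(ltW l0)// lerN2.
  have [||s sl E] := @MVT_segment R g (fun s => 'D_v f (s *: v + x)) _ _ (ltW l0).
  + by move=> s sl; apply/dg/itv/subset_itv_oo_cc.
  + by apply: derivable_within_continuous => s /itv/dg[].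
  by exists s; [exact: itv|rewrite -g0 -/(g l) -opprB E sub0r mulrN opprK mulrC].
Qed.

(** The increment along [h *: (a *: w + v)] splits into a move along [v] from [x], then one along
    [w]. The mean value theorem turns the second into [h * a] times a [w]-derivative at a point
    tending to [x], where that derivative is continuous. *)
Lemma is_derive_addv (R : realType) (V : normedModType R) (f : V -> R)
    (x v w : V) (a d : R) :
  is_derive x v f d -> (\forall y \near x, derivable f y w) ->
  {for x, continuous (fun y => 'D_w f y)} ->
  is_derive x (a *: w + v) f (a * 'D_w f x + d).
Proof.
move=> dv dw cw.
suff C : (fun h : R => h^-1 *: ((f \o shift x) (h *: (a *: w + v)) - f x)) @ 0^'
    --> a * 'D_w f x + d.
  by split; [apply/cvg_ex; eexists; exact: C|exact: cvg_lim C].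
have -> : (fun h : R => h^-1 *: ((f \o shift x) (h *: (a *: w + v)) - f x)) =
   (fun h : R => h^-1 *: (f ((h * a) *: w + (h *: v + x)) - f (h *: v + x))) \+
   (fun h : R => h^-1 *: ((f \o shift x) (h *: v) - f x)).
  apply/funext => h /=; rewrite -scalerDr subrKA.
  by rewrite (scalerDr h) scalerA addrA.
apply: cvgD; last by case: dv => dv <-.
apply/cvgrPdist_le => e e0.
have ca : {for x, continuous (fun y => a * 'D_w f y)}.
  by apply: continuousM => //; exact: cst_continuous.
move/cvgrPdist_le : ca => /(_ _ e0) ca.
have : \forall y \near x,
   `|a * 'D_w f x - a * 'D_w f y| <= e /\ derivable f y w by near do split.
move=> /nbhs_normP[r /= r0 rP].
(* [K * |h|] bounds the distance from [x] to every intermediate point; the [+ 1] keeps [K]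
   positive. *)
pose K := `|a| * `|w| + `|v| + 1.
have K0 : 0 < K by rewrite ltr_wpDl// addr_ge0// mulr_ge0.
have rK0 : 0 < r / K by rewrite divr_gt0.
have inr h s : `|h| < r / K -> `|s| <= `|h * a| ->
    `|x - (s *: w + (h *: v + x))| < r.
  rewrite ltr_pdivlMr// => hr sh.
  rewrite addrA opprD [- (_ + _) - x]addrC addrA subrr add0r normrN.
  apply: le_lt_trans hr; rewrite (le_trans (ler_normD _ _))// !normrZ.
  rewrite /K mulrDr mulr1 mulrDr mulrA -normrM.
  rewrite -[leLHS]addr0 lerD// lerD// ler_wpM2r//.
near=> h.
have h0 : h != 0 by near: h; exact: nbhs_dnbhs_neq.
have hr : `|h| < r / K.
  near: h; apply: nbhs_dnbhs.
  by apply/nbhs_normP; exists (r / K) => // z /=; rewrite sub0r normrN.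
have [|s sh ->] := @MVT_line R V f (h *: v + x) w (h * a).
  by move=> s sh; apply: (rP _ _).2; exact: inr.
rewrite -[_ *: _]/(h^-1 * _) !mulrA mulVf// mul1r.
by apply: (rP _ _).1; exact: inr.
Unshelve. all: by end_near. Qed.

(** [C2_on] speaks only of coordinate directions; a general [v] is built up one coordinate at a time
    with [is_derive_addv]. *)
Lemma is_derive_partial (R : realType) (n : nat) (f : 'rV[R]_n -> R)
    (x v : 'rV[R]_n) :
  (forall i, \forall y \near x, derivable f y (evec R i)) ->
  (forall i, {for x, continuous (partial f i)}) ->
  is_derive x v f (\sum_(i < n) v 0 i * partial f i x).
Proof.
move=> df cf; rewrite {1}(row_sum_delta v).
elim/big_rec2: _ => [|i w d _ IH]; first exact: is_derive0.
by apply: is_derive_addv => //; [exact: df|exact: cf].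
Qed.

Lemma C2_on_is_derive (R : realType) (n : nat) (O : set 'rV[R]_n)
    (phi : 'rV[R]_n -> R) (x w : 'rV[R]_n) :
  open O -> C2_on O phi -> O x ->
  is_derive x w phi (\sum_(i < n) w 0 i * partial phi i x).
Proof.
move=> oO [_ [c1 [_ d]]] Ox; apply: is_derive_partial => i.
  by near do apply: (d _ _ i).1; exact: open_nbhs_nbhs.
by move: (c1 i); rewrite continuous_open_subspace//; apply; rewrite inE.
Unshelve. all: by end_near. Qed.

Lemma C2_on_is_derive_partial (R : realType) (n : nat) (O : set 'rV[R]_n)
    (phi : 'rV[R]_n -> R) (x w : 'rV[R]_n) (i : 'I_n) :
  open O -> C2_on O phi -> O x ->
  is_derive x w (partial phi i)
    (\sum_(j < n) w 0 j * partial (partial phi i) j x).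
Proof.
move=> oO [_ [_ [c2 d]]] Ox; apply: is_derive_partial => j.
  by near do apply: (d _ _ i).2; exact: open_nbhs_nbhs.
by move: (c2 i j); rewrite continuous_open_subspace//; apply; rewrite inE.
Unshelve. all: by end_near. Qed.

(** * Second-order lower bound at a critical point *)

(** Restricting [phi] to the segment from [x] to [y] gives a function of one variable with zero
    slope at 0 and second derivative at least [c * N]; two uses of the mean value theorem integrate
    this bound. *)
Lemma quadratic_growth (R : realType) (n : nat) (O : set 'rV[R]_n)
    (phi : 'rV[R]_n -> R) (x : 'rV[R]_n) (r c : R) :
  open O -> C2_on O phi -> grad phi x = 0 ->
  (forall y, `|y - x| <= r -> O y) ->
  (forall y w : 'rV[R]_n, `|y - x| <= r ->
    c * (\sum_(i < n) w 0 i ^+ 2) <=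
    \sum_(i < n) \sum_(j < n) w 0 i * hess phi y i j * w 0 j) ->
  forall y, `|y - x| <= r ->
    c / 2 * (\sum_(i < n) (y - x) 0 i ^+ 2) <= phi y - phi x.
Proof.
move=> oO C2 g0 inO H y yr.
pose w := y - x.
pose N := \sum_(i < n) w 0 i ^+ 2.
pose l (t : R) := t *: w + x.
have lr (t : R) : 0 <= t <= 1 -> `|l t - x| <= r.
  move=> /andP[t0 t1]; rewrite /l addrK normrZ ger0_norm//.
  by apply: le_trans yr; rewrite ler_piMl.
have lO t : 0 <= t <= 1 -> O (l t) by move=> /lr/inO.
pose g : R -> R := fun t => phi (l t).
pose g1 : R -> R :=
  \sum_(i < n) w 0 i *: ((fun t => partial phi i (l t)) : R -> R).
pose g2 (t : R) : R :=
  \sum_(i < n) w 0 i * \sum_(j < n) w 0 j * partial (partial phi i) j (l t).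
have g1E t : g1 t = \sum_(i < n) w 0 i * partial phi i (l t).
  by rewrite /g1 fct_sumE.
have dg (t : R) : 0 <= t <= 1 -> is_derive t 1 g (g1 t).
  move=> t01; rewrite g1E; apply: is_derive_line.
  by apply: C2_on_is_derive oO C2 _; exact: lO.
have dg1 (t : R) : 0 <= t <= 1 -> is_derive t 1 g1 (g2 t).
  move=> t01; apply: is_derive_sum => i; apply: is_deriveZ.
  apply: is_derive_line.
  by apply: C2_on_is_derive_partial oO C2 _; exact: lO.
have g10 : g1 0 = 0.
  rewrite g1E big1// => i _; rewrite /l scale0r add0r.
  by move/rowP/(_ i) : g0; rewrite !mxE => ->; rewrite mulr0.
have g2N t : 0 <= t <= 1 -> c * N <= g2 t.
  move=> t01; apply: le_trans (H _ w (lr _ t01)) _.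
  (* [hess] and [g2] index the mixed derivatives in opposite orders; exchanging the sums reconciles
     them without appeal to symmetry of the Hessian. *)
  rewrite exchange_big /=; apply: ler_sum => i _; rewrite mulr_sumr.
  by apply: ler_sum => j _; rewrite [hess _ _ _ _]mxE mulrC.
have g1N t : 0 <= t <= 1 -> c * N * t <= g1 t.
  move=> /andP[t0 t1].
  have st s : s \in `[0, t] -> 0 <= s <= 1.
    by rewrite in_itv /= => /andP[-> /le_trans -> //].
  have [||s sl E] := @MVT_segment R g1 g2 _ _ t0.
  + by move=> s sl; apply/dg1/st/subset_itv_oo_cc.
  + by apply: derivable_within_continuous => s /st/dg1[].
  move: E; rewrite g10 !subr0 => ->; rewrite ler_wpM2r//.
  exact/g2N/st.
(* By [g1N], [F] has nonnegative derivative on the unit interval, and the claim is [F 0 <= F 1]. *)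
pose F : R -> R := g - (c / 2 * N) *: (id ^+ 2 : R -> R).
have dF (t : R) : 0 <= t <= 1 -> is_derive t 1 F (g1 t - c * N * t).
  move=> t01; have := dg t t01 => dgt.
  apply: is_derive_eq; rewrite /= -![_ *: _]/(_ * _) expr1.
  by field.
have [||s sl E] := @MVT_segment R F (fun t => g1 t - c * N * t) _ _ (@ler01 R).
+ by move=> s sl; apply/dF; move/subset_itv_oo_cc : sl; rewrite in_itv.
+ by apply: derivable_within_continuous => s; rewrite in_itv => /dF[].
have : 0 <= F 1 - F 0.
  by rewrite E subr0 mulr1 subr_ge0 g1N// -in_itv.
have FE t : F t = phi (l t) - c / 2 * N * t ^+ 2 by [].
rewrite !FE /l scale0r add0r scale1r subrK.
by rewrite -/w -/N; lra.
Qed.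

(** * Quadratic forms and [min_quad] *)

(** Homogeneity reduces to the unit vector [w / sqrt N]. Since [inf] defaults to 0 on a set without
    infimum, positivity of [min_quad A] certifies a genuine infimum. *)
Lemma min_quad_le (R : realType) (n : nat) (A : 'M[R]_n) (w : 'rV[R]_n) :
  0 < min_quad A ->
  min_quad A * (\sum_(i < n) w 0 i ^+ 2) <=
    \sum_(i < n) \sum_(j < n) w 0 i * A i j * w 0 j.
Proof.
move=> A0; pose N := \sum_(i < n) w 0 i ^+ 2.
have N0 : 0 <= N by apply: sumr_ge0 => i _; exact: sqr_ge0.
have [NE|NN] := eqVneq N 0.
  have w0 i : w 0 i = 0.
    move/psumr_eq0P : NE => /(_ (fun i _ => sqr_ge0 _))/(_ i isT)/eqP.
    by rewrite sqrf_eq0 => /eqP.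
  rewrite -/N NE mulr0 big1// => i _; rewrite big1// => j _.
  by rewrite w0 !mul0r.
have sN : 0 < Num.sqrt N by rewrite sqrtr_gt0 lt_neqAle eq_sym NN.
have sNE : Num.sqrt N ^+ 2 = N by rewrite sqr_sqrtr.
have [hi|/inf_out E] := pselect (has_inf [set (\sum_(i < n) \sum_(j < n)
      p 0 i * A i j * p 0 j) |
      p in [set p : 'rV[R]_n | \sum_(i < n) p 0 i ^+ 2 = 1]]); last first.
  by move: A0; rewrite /min_quad E ltxx.
rewrite -/N -ler_pdivlMr ?lt_neqAle 1?eq_sym ?NN//.
apply: (ge_inf hi.2); exists ((Num.sqrt N)^-1 *: w) => /=.
  under eq_bigr do rewrite mxE exprMn exprVn sNE.
  by rewrite -mulr_sumr -/N mulVf.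
rewrite mulr_suml; apply: eq_bigr => i _; rewrite mulr_suml.
apply: eq_bigr => j _; rewrite !mxE -{3}sNE.
by field; rewrite gt_eqF.
Qed.

(** In dimension 0 the unit sphere is empty and [inf] takes its default value 0. *)
Lemma min_quad_gt0_dim (R : realType) (n : nat) (A : 'M[R]_n) :
  0 < min_quad A -> (0 < n)%N.
Proof.
case: n A => // A; rewrite /min_quad inf_out ?ltxx// => -[[_ [p /= + _]] _].
by rewrite big_ord0 => /eqP; rewrite eq_sym oner_eq0.
Qed.

(** Each of the [n ^ 2] terms changes by at most [e * |w_i * w_j|], and every [|w_i * w_j|] is at
    most the sum of squares. *)
Lemma quad_form_perturb (R : realType) (n : nat) (A B : 'M[R]_n)
    (w : 'rV[R]_n) (e : R) :
  (forall i j, `|A i j - B i j| <= e) ->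
  \sum_(i < n) \sum_(j < n) w 0 i * A i j * w 0 j
    - e * n%:R ^+ 2 * (\sum_(i < n) w 0 i ^+ 2) <=
  \sum_(i < n) \sum_(j < n) w 0 i * B i j * w 0 j.
Proof.
move=> AB; set N := \sum_(i < n) w 0 i ^+ 2.
have wN i : w 0 i ^+ 2 <= N.
  by rewrite /N (bigD1 i)//= lerDl sumr_ge0// => j _; exact: sqr_ge0.
have -> : e * n%:R ^+ 2 * N = \sum_(i < n) \sum_(j < n) e * N.
  by rewrite !sumr_const card_ord -mulrnA -[RHS]mulr_natr natrM; ring.
rewrite -sumrB; apply: ler_sum => i _; rewrite -sumrB; apply: ler_sum => j _.
rewrite lerBlDr -lerBlDl.
have -> : w 0 i * A i j * w 0 j - w 0 i * B i j * w 0 j =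
  (A i j - B i j) * (w 0 i * w 0 j) by ring.
rewrite (le_trans (ler_norm _))// normrM ler_pM// ler_norml.
by apply/andP; split; have := wN i; have := wN j; nra.
Qed.

(** * Paraboloids as test functions *)

Lemma is_derive_coord (R : realType) (n : nat) (i : 'I_n) (x v : 'rV[R]_n) :
  is_derive x v (fun y : 'rV[R]_n => y 0 i) (v 0 i).
Proof.
suff C : (fun h : R => h^-1 *: (((fun y : 'rV[R]_n => y 0 i) \o shift x)
    (h *: v) - x 0 i)) @ 0^' --> v 0 i.
  by split; [apply/cvg_ex; eexists; exact: C|exact: cvg_lim C].
apply: cvg_near_cst; near=> h.
have h0 : h != 0 by near: h; exact: nbhs_dnbhs_neq.
by rewrite /= !mxE addrK [_ *: _]mulrA mulVf// mul1r.
Unshelve. all: by end_near. Qed.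

(** Squares are summed explicitly because the norm on row vectors is the max norm. The factor 1/2
    makes the Hessian [c] times the identity. *)
Definition paraboloid (R : realType) (n : nat) (c : R) (z y : 'rV[R]_n) : R :=
  c / 2 * \sum_(i < n) (y 0 i - z 0 i) ^+ 2.

Section Paraboloid.
Variables (R : realType) (n : nat) (c : R) (z : 'rV[R]_n).

Lemma paraboloidE : paraboloid c z = (c / 2) *:
  \sum_(i < n) ((fun y : 'rV[R]_n => y 0 i) - cst (z 0 i)) ^+ 2.
Proof. by apply/funext => x; rewrite /= fctE fct_sumE. Qed.

Lemma is_derive_paraboloid (y v : 'rV[R]_n) :
  is_derive y v (paraboloid c z) (\sum_(i < n) c * (y 0 i - z 0 i) * v 0 i).
Proof.
rewrite paraboloidE.
have dc := fun i => is_derive_coord i y v.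
apply: is_derive_eq; rewrite scaler_sumr; apply: eq_bigr => i _.
rewrite -![_ *: _]/(_ * _) subr0 expr1 /= /cst.
rewrite -[(_ - _) y]/(y 0 i - z 0 i); by field.
Qed.

Lemma partial_paraboloid (i : 'I_n) :
  partial (paraboloid c z) i = fun y => c * (y 0 i - z 0 i).
Proof.
apply/funext => y; rewrite /partial.
have [_ ->] := is_derive_paraboloid y (evec R i).
rewrite (bigD1 i)//= big1 ?addr0 => [|j ji]; rewrite mxE eqxx /=.
  by rewrite eqxx mulr1.
by rewrite (negbTE ji) mulr0.
Qed.

Lemma is_derive_partial_paraboloid (i j : 'I_n) (y : 'rV[R]_n) :
  is_derive y (evec R j) (partial (paraboloid c z) i) (c * (i == j)%:R).
Proof.
rewrite partial_paraboloid.
have -> : (fun y : 'rV[R]_n => c * (y 0 i - z 0 i)) =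
  c *: ((fun y : 'rV[R]_n => y 0 i) - cst (z 0 i)) by [].
have dc := is_derive_coord i y (evec R j).
by apply: is_derive_eq; rewrite subr0 mxE eqxx.
Qed.

Lemma continuous_paraboloid : continuous (paraboloid c z).
Proof.
suff H (y : 'rV[R]_n) : {for y, continuous (paraboloid c z)} by move=> y; exact: H.
apply: differentiable_continuous; rewrite paraboloidE.
apply: differentiableZ; apply: differentiable_sum => i.
apply: differentiableX; apply: differentiableB; last exact: differentiable_cst.
exact: differentiable_coord.
Qed.

Lemma C2_on_paraboloid (O : set 'rV[R]_n) : C2_on O (paraboloid c z).
Proof.
split; first exact/continuous_subspaceT/continuous_paraboloid.
split=> [i|].
  apply: continuous_subspaceT; rewrite partial_paraboloid.
  suff H (y : 'rV[R]_n) : {for y, continuous (fun y : 'rV[R]_n =>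
      c * (y 0 i - z 0 i))} by move=> y; exact: H.
  apply: continuousM; first exact: cst_continuous.
  by apply: continuousB; [exact: coord_continuous|exact: cst_continuous].
split=> [i j|y _ i].
  apply: continuous_subspaceT.
  rewrite (_ : partial _ j = cst (c * (i == j)%:R)); first exact: cst_continuous.
  by apply/funext => y; case: (is_derive_partial_paraboloid i j y).
split; first by case: (is_derive_paraboloid y (evec R i)).
by move=> j; case: (is_derive_partial_paraboloid i j y).
Qed.

Lemma grad_norm2_paraboloid (y : 'rV[R]_n) :
  grad_norm2 (paraboloid c z) y =
    c ^+ 2 * \sum_(i < n) (y 0 i - z 0 i) ^+ 2.
Proof.
rewrite /grad_norm2 mulr_sumr; apply: eq_bigr => i _.
by rewrite mxE partial_paraboloid exprMn.
Qed.

(** The Hessian being [c] times the identity, [inf_lap] is [c] times [grad_norm2]; for [c > 1] this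
    exceeds [grad_norm2] away from [z]. *)
Lemma inf_lap_paraboloid (y : 'rV[R]_n) :
  inf_lap (paraboloid c z) y =
    c ^+ 3 * \sum_(i < n) (y 0 i - z 0 i) ^+ 2.
Proof.
rewrite /inf_lap mulr_sumr; apply: eq_bigr => i _.
have hE j : hess (paraboloid c z) y i j = c * (j == i)%:R.
  by rewrite mxE; case: (is_derive_partial_paraboloid j i y).
rewrite (bigD1 i)//= big1 ?addr0 => [|j ji]; rewrite hE.
  by rewrite eqxx !mxE partial_paraboloid /=; ring.
by rewrite (negbTE ji) !mulr0.
Qed.

End Paraboloid.

(** * Norm comparisons and the contact argument *)

Lemma normr_coord_le (R : realType) (n : nat) (x : 'rV[R]_n) (i : 'I_n) :
  `|x 0 i| <= `|x|.
Proof.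
rewrite [leRHS]/Num.norm /= mx_normrE; apply/bigmax_geP; right => /=.
by exists (0, i).
Qed.

(** The max norm is attained at some coordinate, whose square is one of the summands. *)
Lemma sqr_normr_le (R : realType) (n : nat) (x : 'rV[R]_n) :
  `|x| ^+ 2 <= \sum_(i < n) x 0 i ^+ 2.
Proof.
have [->|/mx_norm_neq0[[k i] E]] := eqVneq `|x| 0.
  by rewrite expr0n sumr_ge0// => i _; exact: sqr_ge0.
rewrite [`|x|]E /= ord1 -normrX ger0_norm ?sqr_ge0//.
by rewrite (bigD1 i)//= lerDl sumr_ge0// => j _; exact: sqr_ge0.
Qed.

(* A minimum of [u] less a paraboloid of opening [c > 1] centred at [z] can only
   be at [z], because elsewhere the paraboloid is a strict subsolution. *)
Lemma paraboloid_contact (R : realType) (n : nat) (O : set 'rV[R]_n)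
    (u : 'rV[R]_n -> R) (c : R) (z y : 'rV[R]_n) :
  visc_sol_inflap_grad O u -> 1 < c -> O y ->
  loc_min (fun t => u t - paraboloid c z t) y -> y = z.
Proof.
move=> [_ hu] c1 Oy /(hu _ _ (C2_on_paraboloid c z O) Oy).2.
rewrite inf_lap_paraboloid grad_norm2_paraboloid.
set N := \sum_(i < n) _ => h.
have N0 : 0 <= N by apply: sumr_ge0 => i _; exact: sqr_ge0.
have {h N0} NE : N = 0.
  have c3 : 0 < c ^+ 3 - c ^+ 2.
    by rewrite exprS -[X in _ - X]mul1r -mulrBl mulr_gt0 ?subr_gt0// exprn_gt0; lra.
  by apply/eqP; rewrite eq_le N0 andbT -(pmulr_rle0 _ c3) mulrBl.
apply/rowP => i; apply/eqP; rewrite -subr_eq0 -sqrf_eq0; apply/eqP.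
by move/psumr_eq0P : NE; apply => // j _; exact: sqr_ge0.
Qed.

Lemma no_quadratic_minimum (R : realType) (n : nat) (O : set 'rV[R]_n)
    (u : 'rV[R]_n -> R) (x : 'rV[R]_n) (r m : R) :
  visc_sol_inflap_grad O u -> (0 < n)%N -> 0 < r -> 1 < m ->
  (forall y, `|y - x| <= r -> O y) ->
  (forall y, `|y - x| <= r ->
    m / 2 * (\sum_(i < n) (y - x) 0 i ^+ 2) <= u y - u x) ->
  False.
Proof.
move=> hu n0 r0 m1 rO growth.
pose c := (1 + m) / 2.
have c1 : 1 < c by rewrite /c; lra.
have cm : c < m by rewrite /c; lra.
(* Positive dimension supplies an axis along which to move [z] off [x]. *)
pose k := Ordinal n0.
(* [d] is small enough for the contact point to stay off the boundary of the
   ball: there [(m - c) / 2 * r <= c * d] would hold. *)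
pose d := Num.min r ((m - c) / 2 * r / (2 * c)).
have d0 : 0 < d.
  by rewrite lt_min r0 /= divr_gt0 ?mulr_gt0//; lra.
have dr : d <= r by rewrite ge_min lexx.
have dc : c * d < (m - c) / 2 * r.
  have : d <= (m - c) / 2 * r / (2 * c) by rewrite ge_min lexx orbT.
  rewrite ler_pdivlMr; last by lra.
  have : 0 < (m - c) / 2 * r by rewrite mulr_gt0//; lra.
  by lra.
pose z := x + d *: evec R k.
have zxE i : (z - x) 0 i = d * (i == k)%:R.
  by rewrite /z addrC addKr !mxE eqxx.
have zxr : `|z - x| <= r.
  rewrite [leLHS]/Num.norm /= mx_normrE; apply: bigmax_le; first exact: ltW.
  move=> [j i] _ /=; rewrite ord1 zxE normrM (ger0_norm (ltW d0)).
  by case: eqP => _; rewrite ?normr1 ?normr0 ?mulr1 ?mulr0// ltW.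
pose N (y : 'rV[R]_n) := \sum_(i < n) (y - x) 0 i ^+ 2.
have Nx : N x = 0 by rewrite /N big1// => i _; rewrite subrr mxE expr0n.
have xk : (x - x) 0 k = 0 by rewrite subrr mxE.
have Nz : N z = d ^+ 2.
  rewrite /N (bigD1 k)//= big1 ?addr0 => [|i ik]; rewrite zxE.
    by rewrite eqxx mulr1.
  by rewrite (negbTE ik) mulr0 expr0n.
have pE y : paraboloid c z y = c / 2 * (N y - 2 * d * (y - x) 0 k + d ^+ 2).
  rewrite /paraboloid /N (bigD1 k)//= [in RHS](bigD1 k)//=; congr (_ * _).
  have yzE i : y 0 i - z 0 i = (y - x) 0 i - d * (i == k)%:R.
    by rewrite -zxE !mxE; ring.
  rewrite yzE eqxx mulr1.
  under eq_bigr => i ik do rewrite yzE (negbTE ik) mulr0 subr0.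
  by ring.
pose K := [set y : 'rV[R]_n | `|y - x| <= r].
have cK : compact K.
  have KE : K = closed_ball_ Num.norm x r.
    by apply/seteqP; split => y; rewrite /K /closed_ball_ /= distrC.
  rewrite KE.
  apply: bounded_closed_compact; last exact: closed_closed_ball_.
  exists (`|x| + r); split; first by rewrite num_real.
  move=> M hM y /= yr; apply: le_trans (ltW hM).
  by rewrite -lerBlDl (le_trans (lerB_dist _ _))// distrC.
have [||y yK ymin] := EVT_min_rV (f := fun t => u t - paraboloid c z t) _ cK.
- by exists x; rewrite /K /= subrr normr0 ltW.
- apply: (@continuous_subspaceW _ _ _ O); first by move=> y /rO.
  apply: within_continuousB; first by case: hu.
  exact/continuous_subspaceT/continuous_paraboloid.
rewrite inE /K /= in yK.
have ymin' t : `|t - x| <= r ->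
    u y - paraboloid c z y <= u t - paraboloid c z t.
  by move=> tr; apply: ymin; rewrite inE.
(* Interior minimum: contact forces [y = z], and comparison with [x] gives
   [u z <= u x - c / 2 * d ^ 2], against growth. *)
have [yr|ry] := ltP `|y - x| r.
  have yB : \forall t \near y, `|t - x| <= r.
    apply/nbhs_normP; exists (r - `|y - x|); first by rewrite /= subr_gt0.
    move=> t /=; rewrite ltrBrDr distrC => /ltW; apply: le_trans.
    exact: ler_distD.
  have yz : y = z.
    apply: paraboloid_contact hu c1 (rO _ yK) _.
    exact: filterS yB.
  have := ymin' x; rewrite subrr normr0 => /(_ (ltW r0)).
  have := growth _ zxr.
  rewrite -/(N z) yz !pE Nx Nz zxE eqxx mulr1 xk.
  have : 0 < (m + c) * d ^+ 2 by rewrite mulr_gt0 ?exprn_gt0//; lra.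
  by lra.
(* Boundary minimum: growth and comparison with [x] give [(m - c) / 2 * N y <= - c * d * (y - x)_k].
   The left side is at least [(m - c) / 2 * r ^ 2] and the right at most [c * d * r], against
   [dc]. *)
have := ymin' x; rewrite subrr normr0 => /(_ (ltW r0)).
have := growth _ yK.
rewrite -/(N y) !pE Nx xk.
have Nr : r ^+ 2 <= N y.
  by apply: le_trans (sqr_normr_le _); rewrite lerXn2r ?nnegrE// ltW.
have qr : - r <= (y - x) 0 k.
  have := le_trans (normr_coord_le (y - x) k) yK.
  by rewrite ler_norml => /andP[].
have : 0 <= (m - c) * (N y - r ^+ 2) by rewrite mulr_ge0//; lra.
have : 0 <= c * d * ((y - x) 0 k + r) by rewrite !mulr_ge0//; lra.
have : 0 < r * ((m - c) / 2 * r - c * d) by rewrite mulr_gt0// subr_gt0.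
by lra.
Qed.

(** * The supersolution property *)

Theorem theorem2p4 (R : realType) (n : nat) (Omega : set 'rV[R]_n)
  (u : 'rV[R]_n -> R) :
  bounded_set Omega -> open Omega ->
  visc_sol_inflap_grad Omega u ->
  visc_supersol_normalized Omega u.
Proof.
move=> _ oO hu phi x C2 Ox mx; split=> [gn0|g0].
  have gN : 0 < grad_norm2 phi x.
    rewrite /grad_norm2 lt_neqAle sumr_ge0 ?andbT; last first.
      by move=> i _; exact: sqr_ge0.
    apply: contra_neq gn0 => /esym/psumr_eq0P g2.
    apply/rowP => i; rewrite [RHS]mxE; apply/eqP; rewrite -sqrf_eq0.
    by apply/eqP/g2 => // j _; exact: sqr_ge0.
  by rewrite ler_pdivrMr// mul1r -subr_le0 (hu.2 _ _ C2 Ox).2.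
rewrite leNgt; apply/negP => q1.
have q0 : 0 < min_quad (hess phi x) by exact: lt_trans q1.
set q := min_quad (hess phi x) in q1 q0.
have n0 := min_quad_gt0_dim q0.
pose m := (1 + q) / 2.
have m1 : 1 < m by rewrite /m; lra.
(* The loss [e * n ^ 2] in [quad_form_perturb] is then [(q - 1) / 2], exactly [q - m]. *)
pose e := (q - 1) / 2 / n%:R ^+ 2.
have nn0 : 0 < n%:R ^+ 2 :> R by rewrite exprn_gt0// ltr0n.
have e0 : 0 < e by rewrite divr_gt0//; lra.
have : \forall y \near x, Omega y /\ u x - phi x <= u y - phi y /\
    forall i j, `|hess phi x i j - hess phi y i j| <= e.
  have hc : \forall y \near x, forall i j, `|hess phi x i j - hess phi y i j| <= e.
    apply: (@filter_forall _ _
      (fun i y => forall j, `|hess phi x i j - hess phi y i j| <= e)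
      (nbhs x) _) => i.
    apply: (@filter_forall _ _
      (fun j y => `|hess phi x i j - hess phi y i j| <= e) (nbhs x) _) => j.
    have := C2.2.2.1 j i; rewrite continuous_open_subspace// => /(_ x).
    rewrite inE => /(_ Ox)/cvgrPdist_le/(_ _ e0).
    by apply: filterS => y; rewrite !mxE.
  near=> y; split; last split.
  - by near: y; exact: open_nbhs_nbhs.
  - by near: y.
  - by near: y.
move=> /nbhs_normP[r /= r0 rP].
(* Halving the radius passes from an open ball to a closed one, which is compact. *)
have rP' y : `|y - x| <= r / 2 -> Omega y /\ u x - phi x <= u y - phi y /\
    forall i j, `|hess phi x i j - hess phi y i j| <= e.
  by move=> yr; apply: rP; rewrite /= distrC; lra.
apply: (@no_quadratic_minimum _ _ Omega u x (r / 2) m) => //.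
- by rewrite divr_gt0.
- by move=> y /rP'[].
(* Touching from below at [x] transfers the growth of [phi] to [u]. *)
move=> y yr; apply: le_trans (_ : phi y - phi x <= _); last first.
  by have [_ [+ _]] := rP' _ yr; lra.
apply: (quadratic_growth oO C2 g0 _ _ yr) => [t /rP'[]//|t w tr].
apply: le_trans (quad_form_perturb w (rP' _ tr).2.2).
rewrite -mulrA [e * _]mulrA /e mulfVK ?gt_eqF//.
have := min_quad_le w q0; rewrite -/q /m.
by lra.
Unshelve. all: by end_near. Qed.
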